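(* Let $G_1$, $G_2$ be generators over event sets $\Sigma_1$, $\Sigma_2$, let $G_k$ be a coordinator (a generator) over $\Sigma_k$ with $\Sigma_1\cap\Sigma_2\subseteq\Sigma_k\subseteq\Sigma_1\cup\Sigma_2$, and let $K\subseteq L_m(G_1\parallel G_2\parallel G_k)$ and $C\subseteq L_m(G_1\parallel G_2\parallel G_k)$ be languages. Then, for the given $C$, the supremal (with respect to inclusion) conditionally strong $C$-observable sublanguage of $K$ (with respect to $G_1,G_2,G_k$ and $Q_{1+k},Q_{2+k},Q_k$) always exists and equals the union of all conditionally strong $C$-observable sublanguages of $K$.
   Context: An event set is a finite nonempty set; $\Sigma^*$ is the set of all finite words over $\Sigma$. A generator $G=(Q,\Sigma,f,q_0,Q_m)$ consists of a finite nonempty state set $Q$, an event set $\Sigma$, a partial transition function $f:Q\times\Sigma\to Q$ (extended to $Q\times\Sigma^*$ in the usual way), an initial state $q_0$ and a set $Q_m\subseteq Q$ of marked states; $L(G)=\{s\in\Sigma^*\mid f(q_0,s)\in Q\}$ is its generated language and $L_m(G)=\{s\in\Sigma^*\mid f(q_0,s)\in Q_m\}\subseteq L(G)$ its marked language. A (regular) language over $\Sigma$ is a set $L\subseteq\Sigma^*$ for which there is a generator $G$ with $L_m(G)=L$. $\overline{L}$ denotes the prefix closure of $L$. For $\Sigma'\subseteq\Sigma$ the projection $\Sigma^*\to\Sigma'^*$ is the homomorphism erasing events outside $\Sigma'$ and fixing events of $\Sigma'$. For $L_1\subseteq\Sigma_1^*$, $L_2\subseteq\Sigma_2^*$, the synchronous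 product is $L_1\parallel L_2=P_1^{-1}(L_1)\cap P_2^{-1}(L_2)\subseteq(\Sigma_1\cup\Sigma_2)^*$, where $P_i:(\Sigma_1\cup\Sigma_2)^*\to\Sigma_i^*$ are projections; the synchronous product of generators satisfies $L(G_1\parallel G_2)=L(G_1)\parallel L(G_2)$ and $L_m(G_1\parallel G_2)=L_m(G_1)\parallel L_m(G_2)$. Let $\Sigma=\Sigma_1\cup\Sigma_2$, let $\Sigma_o\subseteq\Sigma$ be the set of observable events, and write $\Sigma_{i+k}=\Sigma_i\cup\Sigma_k$ and $\Sigma_{j,o}=\Sigma_j\cap\Sigma_o$. $P_k:\Sigma^*\to\Sigma_k^*$ and $P_{i+k}:\Sigma^*\to\Sigma_{i+k}^*$ ($i=1,2$) are projections, and $Q_j:\Sigma_j^*\to\Sigma_{j,o}^*$, for $j=1+k,2+k,k$, are the observation projections. Relative observability: for languages $K\subseteq C\subseteq L$ over an event set $\Delta$ with $L$ prefix-closed, and a projection $Q:\Delta^*\to\Delta_o^*$ with $\Delta_o\subseteq\Delta$, $K$ is $C$-observable with respect to $L$ and $Q$ if for all $s,s'\in\Delta^*$ with $Q(s)=Q(s')$ and all $\sigma\in\Delta$: $s\sigma\in\overline K$, $s'\in\overline C$ and $s'\sigma\in L$ imply $s'\sigma\in\overline K$. Conditional strong relative observability: for languages $K'\subseteq C\subseteq L_m(G_1\parallel G_2\parallel G_k)$, $K'$ is conditionally strong $C$-observable with respect to $G_1,G_2,G_k$ and $Q_{1+k},Q_{2+k},Q_k$ if (1) $P_k(K')$ is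 $P_k(C)$-observable with respect to $L(G_k)$ and $Q_k$, and (2) for $i=1,2$, $P_{i+k}(K')$ is $P_{i+k}(C)$-observable with respect to $L(G_i)\parallel L(G_k)$ and $Q_{i+k}$. In particular, a conditionally strong $C$-observable sublanguage of $K$ is a language $K'\subseteq K$ with $K'\subseteq C$ having this property.
   Formalization: Languages (K, C, the sublanguages K' and the supremal one) are arbitrary sets of words, not necessarily regular: with regular languages only, the union of all conditionally strong C-observable sublanguages can be non-regular, and then no supremal one exists. *)

(* Defs.v *)
From mathcomp Require Import all_boot.
From mathcomp Require Import boolp classical_sets.

Set Implicit Arguments.
Unset Strict Implicit.
Unset Printing Implicit Defensive.

Local Open Scope classical_set_scope.

(* All event sets are subsets of one ambient finite type [E]; a word over
   [S : {set E}] is a [seq E] all of whose letters lie in [S].  A language is an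
   arbitrary set of words: the regular languages are not closed under the
   infinite unions considered here, so regularity is not imposed. *)
Section Languages.
Variable E : finType.
Implicit Types (S D Do : {set E}) (w s : seq E) (K C L : set (seq E)).

Definition words S : set (seq E) := [set w | all (fun e => e \in S) w].

Definition proj S w : seq E := [seq e <- w | e \in S].

Definition pclosure L : set (seq E) := [set s | exists t, L (s ++ t)].

Definition lsync S1 S2 (L1 L2 : set (seq E)) : set (seq E) :=
  words (S1 :|: S2) `&` (proj S1 @^-1` L1 `&` proj S2 @^-1` L2).

(* The observation projection is [proj Do] on words over [D]. *)
Definition rel_observable D Do K C L : Prop :=
  forall s s' e, words D s -> words D s' -> proj Do s = proj Do s' ->
    e \in D ->
    pclosure K (rcons s e) -> pclosure C s' -> L (rcons s' e) ->
    pclosure K (rcons s' e).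

(* The largest member of the family [F] with respect to inclusion. *)
Definition supremal (F : set (set (seq E))) (M : set (seq E)) : Prop :=
  F M /\ forall K, F K -> K `<=` M.

End Languages.

(* [trans q e = None] means that the partial transition function is undefined
   at [(q, e)]; [transP] makes it a function on [state * S]. *)
Record generator (E : finType) (S : {set E}) := Generator {
  state : finType;
  trans : state -> E -> option state;
  init : state;
  marked : {set state};
  transP : forall q e, e \notin S -> trans q e = None
}.

Section Generators.
Variable E : finType.

Fixpoint run (S : {set E}) (G : generator S) (q : state G) (w : seq E) :
    option (state G) :=
  if w is e :: w' then obind (fun q' => run q' w') (trans q e) else Some q.

Definition lang (S : {set E}) (G : generator S) : set (seq E) :=
  [set w | exists q, run (init G) w = Some q].

Definition mlang (S : {set E}) (G : generator S) : set (seq E) :=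
  [set w | exists2 q, run (init G) w = Some q & q \in marked G].

Section Sync.
Variables (S1 S2 : {set E}) (G1 : generator S1) (G2 : generator S2).

(* A component whose event set does not contain [e] stays where it is. *)
Definition stepi (S : {set E}) (G : generator S) (q : state G) (e : E) :
    option (state G) :=
  if e \in S then trans q e else Some q.

Definition sync_trans (q : state G1 * state G2) (e : E) :
    option (state G1 * state G2) :=
  if e \in S1 :|: S2 then
    if stepi q.1 e is Some q1 then
      if stepi q.2 e is Some q2 then Some (q1, q2) else None
    else None
  else None.

Lemma sync_transP q e : e \notin S1 :|: S2 -> sync_trans q e = None.
Proof. by rewrite /sync_trans => /negbTE ->. Qed.

Definition sync : generator (S1 :|: S2) :=
  @Generator E (S1 :|: S2) (state G1 * state G2)%type sync_trans
    (init G1, init G2) (finset.setX (marked G1) (marked G2)) sync_transP.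

Lemma run_sync w (q : state G1 * state G2) (p : state G1 * state G2) :
  run (G := sync) q w = Some p <->
  [/\ words (S1 :|: S2) w, run q.1 (proj S1 w) = Some p.1
    & run q.2 (proj S2 w) = Some p.2].
Proof.
elim: w q => [|e w IHw] [q1 q2].
  by case: p => p1 p2 /=; split => [[<- <-]|[_ [<-] [<-]]].
rewrite /words /= /sync_trans /stepi /= finset.in_setU.
case: (boolP (e \in S1)) => e1; case: (boolP (e \in S2)) => e2 /=;
  last by split => // -[].
- case: (trans q1 e) => [r1|] /=; last by split => // -[].
  by case: (trans q2 e) => [r2|] /=; [exact: IHw | split => // -[]].
- by case: (trans q1 e) => [r1|] /=; [exact: IHw | split => // -[]].
- by case: (trans q2 e) => [r2|] /=; [exact: IHw | split => // -[]].
Qed.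

Lemma lang_sync : lang sync = lsync S1 S2 (lang G1) (lang G2).
Proof.
apply/seteqP; split => w /=.
  by move=> [p /run_sync[? ? ?]]; split => //; split; [exists p.1 | exists p.2].
by move=> [? [[p1 ?] [p2 ?]]]; exists (p1, p2); apply/run_sync.
Qed.

Lemma mlang_sync : mlang sync = lsync S1 S2 (mlang G1) (mlang G2).
Proof.
apply/seteqP; split => w /=.
  move=> [p /run_sync[? ? ?]]; rewrite finset.inE => /andP[? ?].
  by split => //; split; [exists p.1 | exists p.2].
move=> [? [[p1 ? m1] [p2 ? m2]]]; exists (p1, p2); first exact/run_sync.
by rewrite finset.inE /= m1.
Qed.

End Sync.

Section ConditionalObservability.
Variables (S1 S2 Sk So : {set E}).
Variables (G1 : generator S1) (G2 : generator S2) (Gk : generator Sk).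
Implicit Types K C : set (seq E).

Definition cs_observable C K : Prop :=
  [/\ rel_observable Sk (Sk :&: So)
        (proj Sk @` K) (proj Sk @` C) (lang Gk),
      rel_observable (S1 :|: Sk) ((S1 :|: Sk) :&: So)
        (proj (S1 :|: Sk) @` K) (proj (S1 :|: Sk) @` C)
        (lsync S1 Sk (lang G1) (lang Gk))
    & rel_observable (S2 :|: Sk) ((S2 :|: Sk) :&: So)
        (proj (S2 :|: Sk) @` K) (proj (S2 :|: Sk) @` C)
        (lsync S2 Sk (lang G2) (lang Gk))].

Definition cs_observable_sublang C K : set (set (seq E)) :=
  [set K' | [/\ K' `<=` K, K' `<=` C & cs_observable C K']].

End ConditionalObservability.

End Generators.

(* Main.v *)
Require Import Defs.
From mathcomp Require Import all_boot.
From mathcomp Require Import boolp classical_sets.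

Local Open Scope classical_set_scope.

(** In the definition of relative observability the ambient language [C] is
    fixed and [K] enters only through membership of single words in its prefix
    closure.  Prefix closure and projection commute with unions, so the class
    of [C]-observable languages is closed under arbitrary unions; hence the
    union of all conditionally strong [C]-observable sublanguages is itself
    one. *)

Lemma pclosure_bigcup (E : finType) (I : Type) (F : set I)
    (K : I -> set (seq E)) :
  pclosure (\bigcup_(i in F) K i) = \bigcup_(i in F) pclosure (K i).
Proof.
apply/seteqP; split => s.
  by move=> [t [i Fi Kt]]; exists i => //; exists t.
by move=> [i Fi [t Kt]]; exists t, i.
Qed.

(** The premise on [rcons s e] picks an index [i]; the other premises do not depend on [i], so the
    same member also witnesses the conclusion. *)
Lemma rel_observable_bigcup (E : finType) (D Do : {set E}) (I : Type)
    (F : set I) (K : I -> set (seq E)) (C L : set (seq E)) :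
  (forall i, F i -> rel_observable D Do (K i) C L) ->
  rel_observable D Do (\bigcup_(i in F) K i) C L.
Proof.
move=> obsK s s' e Ds Ds' eqo De; rewrite !pclosure_bigcup => -[i Fi Kse] Cs' Ls'.
by exists i => //; apply: (obsK i Fi s).
Qed.

Lemma cs_observable_bigcup (E : finType) (S1 S2 Sk So : {set E})
    (G1 : generator S1) (G2 : generator S2) (Gk : generator Sk) (I : Type)
    (F : set I) (K : I -> set (seq E)) (C : set (seq E)) :
  (forall i, F i -> cs_observable So G1 G2 Gk C (K i)) ->
  cs_observable So G1 G2 Gk C (\bigcup_(i in F) K i).
Proof.
(* In each clause the projected union becomes a union of projections over the same [F]. *)
by move=> obsK; split; rewrite image_bigcup;
  apply: rel_observable_bigcup => i /obsK[].
Qed.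

(** Antisymmetry of inclusion; it carries supremality of the explicit union over to an equation for
    every supremal [M]. *)
Lemma supremal_unique (E : finType) (F : set (set (seq E)))
    (M N : set (seq E)) :
  supremal F M -> supremal F N -> M = N.
Proof.
by move=> [FM ubM] [FN ubN]; apply/seteqP; split; [apply: ubN | apply: ubM].
Qed.

Lemma supremal_cs_observable (E : finType) (S1 S2 Sk So : {set E})
    (G1 : generator S1) (G2 : generator S2) (Gk : generator Sk)
    (K C : set (seq E)) :
  supremal (cs_observable_sublang So G1 G2 Gk C K)
    (\bigcup_(K' in cs_observable_sublang So G1 G2 Gk C K) K').
Proof.
split; last by move=> K' FK'; apply: bigcup_sup.
split.
- by apply: bigcup_sub => K' [].
- by apply: bigcup_sub => K' [].
(* The family is indexed by its own members, so [K'] is both index and language. *)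
- by apply: cs_observable_bigcup => K' [].
Qed.

Theorem theorem8 (E : finType) (S1 S2 Sk So : {set E})
  (S1_neq0 : (0 < #|S1|)%N) (S2_neq0 : (0 < #|S2|)%N) (Sk_neq0 : (0 < #|Sk|)%N)
  (sub_k : S1 :&: S2 \subset Sk) (k_sub : Sk \subset S1 :|: S2)
  (o_sub : So \subset S1 :|: S2)
  (G1 : generator S1) (G2 : generator S2) (Gk : generator Sk)
  (K C : set (seq E))
  (hK : K `<=` mlang (sync (sync G1 G2) Gk))
  (hC : C `<=` mlang (sync (sync G1 G2) Gk)) :
  (exists M, supremal (cs_observable_sublang So G1 G2 Gk C K) M) /\
  (forall M, supremal (cs_observable_sublang So G1 G2 Gk C K) M ->
     M = \bigcup_(K' in cs_observable_sublang So G1 G2 Gk C K) K').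
Proof.
have supU := supremal_cs_observable E S1 S2 Sk So G1 G2 Gk K C.
split; first by eexists; exact: supU.
by move=> M supM; apply: supremal_unique supM supU.
Qed.
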